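(* For every real number $c>0$ there is a constant $C=C(c)$ such that for every finite group $G$ with $d(G)\ge c\,|G|$ there exists a positive integer $m$ with $$\left|\,d(G)-\frac{|G|}{m}\,\right|\le C.$$
   Context: For a finite group $G$, $d(G)$ denotes the size of a minimal faithful $G$-set, i.e. the least integer $d$ such that $G$ embeds in the symmetric group $S_d$. *)

(* Defs.v *)
From mathcomp Require Import all_boot all_order all_fingroup.

Set Implicit Arguments.
Unset Strict Implicit.
Unset Printing Implicit Defensive.

Import GroupScope.

(* G embeds in S_d; d = 0 is allowed, and S_0 is the trivial group. *)
Definition embeds_in_Sym (gT : finGroupType) (G : {group gT}) : pred nat :=
  fun d => [exists H : {group 'S_d}, G \isog H].

Lemma embeds_in_SymP (gT : finGroupType) (G : {group gT}) (d : nat) :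
  reflect (exists f : {morphism G >-> 'S_d}, 'injm f) (embeds_in_Sym G d).
Proof.
apply: (iffP existsP) => [[H /isogP[f injf _]]|[f injf]]; first by exists f.
by exists (f @* G)%G; apply: sub_isog.
Qed.

Lemma embeds_in_Sym_ex (gT : finGroupType) (G : {group gT}) :
  exists d, embeds_in_Sym G d.
Proof.
exists #|gT|; apply/embeds_in_SymP.
pose t (x : gT) (i : 'I_#|gT|) := enum_rank (enum_val i * x).
have t_inj x : injective (t x).
  by move=> i j /enum_rank_inj/mulIg/enum_val_inj.
pose f x := perm (@t_inj x).
have fM : {in G &, {morph f : x y / x * y}}.
  move=> x y _ _; apply/permP=> i.
  by rewrite permM !permE /t enum_rankK mulgA.
exists (Morphism fM); apply/injmP=> x y _ _ /= /permP/(_ (enum_rank 1)).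
by rewrite !permE /t enum_rankK !mul1g => /enum_rank_inj.
Qed.

(* d(G), the least degree of a faithful permutation representation of G *)
Definition min_perm_degree (gT : finGroupType) (G : {group gT}) : nat :=
  ex_minn (embeds_in_Sym_ex G).

(* Main.v *)
Require Import Defs.
From mathcomp Require Import all_boot all_order all_algebra all_fingroup.
From mathcomp Require Import all_solvable.
From mathcomp Require Import reals.

(** If H and L are subgroups of G with H :&: L = 1, then G acts faithfully on
    the union of the two coset spaces, so d(G) <= |G : H| + |G : L|. Hence
    d(G) >= c |G| forces a trivial-intersection bound ([TI_bound]): with K a
    little above 2 / c, two subgroups that meet trivially cannot both have
    order greater than K.

    The heart of the proof is that such a bound forces a cyclic p-subgroup <x>
    of bounded index in G ([TI_cyclic_index]). Sylow subgroups for different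
    primes meet trivially, so at most one prime p has a Sylow subgroup of order
    greater than K. The others have order at most K, and involve only primes up
    to K, so a Sylow p-subgroup P has bounded index. If p > K, then P has no
    elementary abelian subgroup of rank 2 and is cyclic. If p <= K, let A be a
    maximal abelian normal subgroup of P, and write A = <x> x R with x of order
    the exponent of A. The bound makes |A| at most a constant times #[x]. If
    #[x] is small, then A is bounded, and so is P because A is its own
    centraliser in P. If #[x] is large, then |R| <= K, and z := x ^+ |R|
    generates a normal subgroup of P.
    - The centraliser C of z contains A with bounded index: for a in A, the
      C-conjugates of a differ from a by elements of A of order dividing |R|,
      and A is its own centraliser and generated by x and R.
    - The centraliser of z has bounded index in P. On a subgroup of index at
      most p ^ 2, every y raises z to a power u = 1 modulo p ^ 2. For such u the
      sum 1 + u + ... + u ^ (p ^ j - 1) has p-part exactly p ^ j, which makes it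
      possible to correct a suitable power of y by an element of <z> so that the
      result generates a group meeting <x> trivially
      ([cycle_avoiding_coset]); its order is then at most K. This bounds the
      order of the commutator of z and y ([commutator_exp1]), hence the number
      of conjugates of z.

    Finally, let <x> be a nontrivial cyclic p-subgroup of bounded index, and let
    m be the largest order of a subgroup H of G with H :&: <x> = 1. The first
    inequality gives d(G) <= |G| / m + |G : <x>|. Conversely, some point of a
    faithful G-set is moved by the elements of order p of <x>, so its stabiliser
    meets <x> trivially, and d(G) >= |G| / m
    ([min_perm_degree_cyclic_index]). *)

Section Groups.
Set Implicit Arguments.
Unset Strict Implicit.
Unset Printing Implicit Defensive.
Local Open Scope group_scope.

(** * Faithful actions on coset spaces *)

Lemma embeds_in_Sym_faithful (gT : finGroupType) (rT : finType)
    (to : {action gT &-> rT}) (G : {group gT}) (S : {set rT}) :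
  [acts G, on S | to] -> 'C_G(S | to) = 1 -> embeds_in_Sym G #|S|.
Proof.
move=> actsG faithG.
pose t (g : gT) (i : 'I_#|S|) :=
  if g \in G then enum_rank_in (enum_valP i) (to (enum_val i) g) else i.
have tE g i : g \in G -> enum_val (t g i) = to (enum_val i) g.
  move=> Gg; rewrite /t Gg enum_rankK_in //.
  by rewrite (acts_act actsG) ?enum_valP.
have t_inj g : injective (t g).
  have [Gg i j tij | nGg i j] := boolP (g \in G); last by rewrite /t (negPf nGg).
  apply/enum_val_inj/(act_inj to g).
  by rewrite -!tE // tij.
have fM : {in G &, {morph (fun g => perm (@t_inj g)) : x y / x * y}}.
  move=> x y Gx Gy; apply/permP=> i; rewrite permM !permE.
  by apply: enum_val_inj; rewrite !tE ?groupM // actM.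
apply/embeds_in_SymP; exists (Morphism fM); apply/subsetP=> g.
case/setIP=> Gg; rewrite !inE => /eqP /= /permP g1.
suff: g \in 'C_G(S | to) by rewrite faithG => /set1P->.
rewrite inE Gg; apply/astabP => s Ss.
have := g1 (enum_rank_in Ss s); rewrite perm1 permE => /(congr1 enum_val).
by rewrite tE // enum_rankK_in.
Qed.

Lemma min_perm_degree_le (gT : finGroupType) (G : {group gT}) d :
  embeds_in_Sym G d -> min_perm_degree G <= d.
Proof. by rewrite /min_perm_degree; case: ex_minnP => n _; apply. Qed.

(** The kernel of the action on the cosets of H is the core of H, so the action
    on the union of the two coset spaces is faithful. *)
Lemma min_perm_degree_le_index (gT : finGroupType) (G H L : {group gT}) :
    H \subset G -> L \subset G -> H :&: L = 1 ->
  min_perm_degree G <= #|G : H| + #|G : L|.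
Proof.
move=> sHG sLG tiHL; pose S := rcosets H G :|: rcosets L G.
have actsS : [acts G, on S | 'Rs].
  by rewrite (subset_trans _ (astabsU _ _ _)) // subsetI !actsRs_rcosets.
have faithS : 'C_G(S | 'Rs) = 1.
  apply/trivgP; rewrite -tiHL /= /S astabU !astabRs_rcosets.
  by rewrite subIset // setISS ?gcore_sub ?orbT.
apply: leq_trans (min_perm_degree_le (embeds_in_Sym_faithful actsS faithS)) _.
by rewrite /S cardsU leq_subr.
Qed.

(** In a faithful action of least degree some point is moved by z; its orbit has
    at most d(G) points. *)
Lemma min_perm_degree_stabiliser (gT : finGroupType) (G : {group gT}) z :
    z \in G -> z != 1 ->
  exists H : {group gT},
    [/\ H \subset G, z \notin H & #|G : H| <= min_perm_degree G].
Proof.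
move=> Gz ntz; rewrite /min_perm_degree; case: ex_minnP => d.
case/embeds_in_SymP=> f injf _.
have [i mvi] : exists i, f z i != i.
  apply/existsP; rewrite -negb_forall; apply: contra ntz => /forallP fz1.
  rewrite -cycle_eq1 -subG1 cycle_subG.
  apply: (subsetP injf); rewrite !inE Gz /=; apply/eqP/permP => i.
  by rewrite perm1; apply/eqP.
exists 'C_G[i | <<f>>]%G; split; first exact: subsetIl.
  by rewrite !inE Gz sub1set inE /= mactE.
rewrite -(card_orbit_in <<f>> i (subxx G)).
by apply: leq_trans (max_card _) _; rewrite card_ord.
Qed.

(** * Geometric sums and powers in cyclic normal subgroups *)

Lemma geometric_sum_mul u a b :
  (\sum_(i < a * b) u ^ i = (\sum_(i < a) u ^ i) * (\sum_(j < b) (u ^ a) ^ j))%N.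
Proof.
elim: b => [|b IHb]; first by rewrite muln0 !big_ord0 muln0.
rewrite mulnSr big_ord_recr mulnDr -IHb -!(big_mkord xpredT (expn u)) /=.
rewrite (@big_cat_nat _ _ _ (a * b)%N) ?leq_addr //=; congr (_ + _)%N.
rewrite -{1}[(a * b)%N]add0n big_addn addKn big_mkord big_distrl /=.
by rewrite big_mkord; apply: eq_bigr => i _; rewrite expnD expnM.
Qed.

(** By [geometric_sum_mul], the sum over p ^ j.+1 terms is the sum over p ^ j
    terms times a sum of p powers of w := u ^ (p ^ j). As w = 1 modulo p ^ 2, the
    second factor is p modulo p ^ 2, so it contributes exactly one factor p.
    Congruence modulo p would not suffice when p = 2. *)
Lemma logn_geometric_sum p u j :
  prime p -> u = 1 %[mod p ^ 2] -> logn p (\sum_(i < p ^ j) u ^ i) = j.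
Proof.
move=> p_pr u1; have p_gt0 := prime_gt0 p_pr.
have Sgt0 k w : (0 < k)%N -> (0 < \sum_(i < k) w ^ i)%N.
  by case: k => // k _; rewrite big_ord_recl expn0.
elim: j => [|j IHj]; first by rewrite expn0 big_ord1 expn0 logn1.
rewrite expnSr geometric_sum_mul lognM ?Sgt0 ?expn_gt0 ?p_gt0 // IHj -addn1.
congr (_ + _)%N; set w := (u ^ _)%N.
have w1 : w = 1 %[mod p ^ 2] by rewrite /w -modnXm u1 modnXm exp1n.
have: \sum_(i < p) w ^ i = p %[mod p ^ 2].
  have e1: (\sum_(i < p) 1)%N = p by rewrite sum1_card card_ord.
  transitivity ((\sum_(i < p) 1) %% p ^ 2)%N; last by rewrite e1.
  rewrite -modn_summ -[in RHS]modn_summ; congr (_ %% _); apply: eq_bigr => i _.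
  by rewrite -modnXm w1 modnXm exp1n.
move/eqP=> Sp; apply/eqP; rewrite eqn_leq -ltnS.
have [ltp2 p2gt0] : (p < p ^ 2)%N /\ (0 < p ^ 2)%N.
  by rewrite expn_gt0 p_gt0 -{1}[p]expn1 ltn_exp2l ?prime_gt1.
rewrite ltnNge -!pfactor_dvdn ?Sgt0 //; apply/andP; split.
  rewrite /dvdn (eqP Sp) modn_small //; exact: lt0n_neq0.
rewrite expn1 /dvdn -(@modn_dvdm (p ^ 2)) ?dvdn_exp //.
by rewrite (eqP Sp) modn_dvdm ?dvdn_exp // modnn.
Qed.

Lemma conjgX_exp (gT : finGroupType) (g w : gT) u k :
  w ^ g = w ^+ u -> w ^ (g ^+ k) = w ^+ (u ^ k).
Proof.
move=> wg; elim: k => [|k IHk]; first by rewrite conjg1.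
by rewrite expgSr conjgM IHk conjXg wg -expgM expnS.
Qed.

(** Moving every w to the right past the powers of g turns it into
    w, w ^+ u, w ^+ u ^ 2, and so on. *)
Lemma expMg_geometric (gT : finGroupType) (g w : gT) u k :
  w ^ g = w ^+ u -> (g * w) ^+ k = g ^+ k * w ^+ (\sum_(i < k) u ^ i).
Proof.
move=> wg; elim: k => [|k IHk]; first by rewrite big_ord0 mulg1.
rewrite expgS IHk big_ord_recr /= addnC expgD -(conjgX_exp k wg) !mulgA.
by congr (_ * _); rewrite expgS -!mulgA -conjgC.
Qed.

Lemma expg_prime_pow_mul (gT : finGroupType) (w : gT) p k v :
  prime p -> p.-elt w -> ~~ (p %| v) -> w ^+ (k * v) = 1 -> w ^+ k = 1.
Proof.
move=> p_pr pw pv; have co_w_v: coprime #[w] v.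
  by apply: (pnat_coprime pw); rewrite p'natE.
by move/eqP; rewrite -order_dvdn Gauss_dvdl // order_dvdn => /eqP.
Qed.

(** * Indices of centralisers *)

Lemma card_Ldiv_cycle (gT : finGroupType) (x : gT) n :
  (0 < n)%N -> #|'Ldiv_n(<[x]>)| <= n.
Proof.
move=> n_gt0; have gL := group_Ldiv n (cycle_abelian x).
have: cyclic (Group gL) by apply: cyclicS (cycle_cyclic x); apply: subsetIl.
move/exponent_cyclic=> /= <-; apply: dvdn_leq => //.
by apply/exponentP=> y /LdivP[].
Qed.

Lemma indexI_leq (gT : finGroupType) (G H K : {group gT}) :
  H \subset G -> K \subset G -> #|G : H :&: K| <= #|G : H| * #|G : K|.
Proof.
move=> sHG sKG; rewrite -(Lagrange_index sHG (subsetIl H K)) leq_mul //.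
rewrite indexgI -(leq_pmul2l (cardG_gt0 K)) LagrangeMl Lagrange //.
by rewrite subset_leq_card // mul_subG.
Qed.

Lemma index_cent_set (gT : finGroupType) (G : {group gT}) (s : seq gT) q :
    (forall x, x \in s -> #|x ^: G| <= q) ->
  #|G : 'C_G([set x in s])| <= q ^ size s.
Proof.
elim: s => [|x s IHs] sq.
  rewrite (_ : 'C_G(_) = G) ?indexgg //; apply/setIidPl/centsP=> g _ y.
  by rewrite inE.
rewrite set_cons centU setIIr expnS.
apply: leq_trans (indexI_leq (subsetIl _ _) (subsetIl _ _)) _.
apply: leq_mul; last by apply: IHs => y sy; rewrite sq // inE sy orbT.
by rewrite /= cent_set1 index_cent1 sq ?mem_head.
Qed.

(** * Abelian groups with a trivial-intersection bound *)

Definition TI_bound (gT : finGroupType) K (G : {group gT}) :=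
  forall H L : {group gT},
    H \subset G -> L \subset G -> H :&: L = 1 -> minn #|H| #|L| <= K.

Lemma TI_boundS (gT : finGroupType) K (G H : {group gT}) :
  H \subset G -> TI_bound K G -> TI_bound K H.
Proof.
by move=> sHG tiG A B sAH sBH; apply: tiG; apply: subset_trans sHG.
Qed.

Lemma TI_bound_large (gT : finGroupType) K (G H L : {group gT}) :
    TI_bound K G -> H \subset G -> L \subset G -> H :&: L = 1 ->
  K < #|H| -> #|L| <= K.
Proof.
move=> tiG sHG sLG tiHL ltKH; have := tiG H L sHG sLG tiHL.
by rewrite geq_min leqNgt ltKH.
Qed.

Lemma abelian_dprod_cycle_exponent (gT : finGroupType) (A : {group gT}) :
    abelian A ->
  exists x, exists R : {group gT}, #[x] = exponent A /\ <[x]> \x R = A.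
Proof.
move=> cAA; have [x Ax ox] := exponent_witness (abelian_nil cAA).
have /splitsP[R /complP[tixR defA]] := abelian_splits Ax (esym ox) cAA.
exists x, R; split=> //; rewrite dprodE // (sub_abelian_cent2 cAA) ?cycle_subG //.
by rewrite -defA mulG_subr.
Qed.

(** Split off a cyclic factor of order the exponent and recurse on its complement
    R as long as |R| >= B; once |R| < B the whole current group is small enough
    to be the factor H. *)
Lemma abelian_dprod_factor (gT : finGroupType) (A : {group gT}) B :
    abelian A -> 0 < B <= #|A| ->
  exists H : {group gT}, exists2 L : {group gT},
    H \x L = A & B <= #|H| <= B * exponent A.
Proof.
have [m] := ubnP #|A|; elim: m A => // m IHm A /ltnSE-leAm cAA /andP[B0 leBA].
have [x [R [ox defA]]] := abelian_dprod_cycle_exponent cAA.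
have oA := dprod_card defA; have /dprodP[_ /= defA' _ _] := defA.
have sRA : R \subset A by rewrite -defA' mulG_subr.
have [leBR | ltRB] := leqP B #|R|; last first.
  exists A, 1%G; first by rewrite dprodg1.
  by rewrite leBA -oA mulnC -ox leq_mul // ltnW.
have [x1 | ntx] := eqVneq x 1.
  have A1 : A :=: 1 by apply/eqP; rewrite trivg_exponent -ox x1 order1.
  exists A, 1%G; first by rewrite dprodg1.
  by rewrite leBA A1 cards1 muln_gt0 B0 exponent_gt0.
have ltRA : #|R| < #|A| by rewrite -oA ltn_Pmull ?order_gt1 ?cardG_gt0.
have [|||H [L defR /andP[leBH leHe]]] := IHm R.
- exact: leq_trans leAm.
- exact: abelianS sRA cAA.
- by rewrite B0.
have defHA : H \x (<[x]> \x L) = A.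
  by rewrite dprodA (dprodC H) -dprodA defR.
have /dprodP[[H1 L1 _ defL1] _ _ _] := defHA.
exists H, L1; first by rewrite -defL1.
rewrite leBH (leq_trans leHe) // leq_mul // dvdn_leq ?exponent_gt0 //.
exact: exponentS.
Qed.

(** A direct factor H of order just above K forces its complement to have order
    at most K. *)
Lemma TI_bound_abelian (gT : finGroupType) K (A : {group gT}) :
  abelian A -> TI_bound K A -> #|A| <= K.+1 * exponent A * K.
Proof.
move=> cAA tiA; have K_gt0 : 0 < K.
  by have := tiA 1%G 1%G (sub1G A) (sub1G A) (setIid 1); rewrite !cards1.
have [leAK | ltKA] := leqP #|A| K.
  by apply: leq_trans leAK _; rewrite leq_pmull // muln_gt0 exponent_gt0.
have [|H [L defA /andP[ltKH leHe]]] := abelian_dprod_factor (B := K.+1) cAA.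
  by rewrite ltnS.
have /dprodP[_ /= defA' _ tiHL] := defA; rewrite -(dprod_card defA).
rewrite leq_mul // (TI_bound_large tiA _ _ tiHL) // -defA'.
  exact: mulG_subl.
exact: mulG_subr.
Qed.

(** * Correcting an element by a normal cyclic subgroup *)

(** Take w in <z> for which g := y * w has least order p ^ r.+1. If <g> met <x>,
    then g ^+ (p ^ r) would lie in the subgroup of order p of <x>. Multiplying g
    by z ^+ t multiplies its p ^ r-th power by z ^+ (t * S), where S is a
    geometric sum with p-part p ^ r. As #[g] <= #[z], the subgroup <[z ^+ S]> is
    not trivial, so it contains that subgroup of order p, and some t cancels
    g ^+ (p ^ r), against the minimality of the order. *)
Lemma cycle_avoiding_coset (gT : finGroupType) p (P : {group gT}) x y z u :
    prime p -> p.-group P -> x \in P -> y \in P -> z \in <[x]> ->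
    z ^ y = z ^+ u -> u = 1 %[mod p ^ 2] -> #[y] <= #[z] ->
  exists2 w, w \in <[z]> & <[y * w]> :&: <[x]> = 1.
Proof.
move=> p_pr pP Px Py Xz zy u1 leyz.
case: (@arg_minnP _ 1 [in <[z]>] (fun w => #[y * w])) => [|w Zw minw].
  exact: group1.
exists w => //; set g := y * w; apply/eqP/idPn => ntI.
have sxP : <[x]> \subset P by rewrite cycle_subG.
have Pz : z \in P := subsetP sxP z Xz.
have Pg : g \in P by rewrite groupM // (subsetP _ w Zw) // cycle_subG.
have [pz pg] := (mem_p_elt pP Pz, mem_p_elt pP Pg).
have ntg : g != 1.
  by apply: contra ntI => /eqP->; rewrite cycle1 (setIidPl (sub1G _)).
have [r og] : exists r, #[g] = (p ^ r.+1)%N.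
  have [[|r] og] := p_natP pg; last by exists r.
  by rewrite -order_eq1 og in ntg.
have le_og_oz : #[g] <= #[z].
  by apply: leq_trans leyz; have := minw 1 (group1 _); rewrite mulg1.
have zg : z ^ g = z ^+ u.
  rewrite conjgM zy conjXg; congr (_ ^+ _); apply/conjg_fixP/commgP.
  exact: (centsP (cycle_abelian z)) _ (cycle_id z) _ Zw.
pose S := (\sum_(i < p ^ r) u ^ i)%N; have logS := logn_geometric_sum r p_pr u1.
have [v pv defS] : exists2 v, ~~ (p %| v) & S = (p ^ r * v)%N.
  have S_gt0 : 0 < S.
    have: 0 < p ^ r by rewrite expn_gt0 prime_gt0.
    by rewrite /S; case: (p ^ r)%N => // k _; rewrite big_ord_recl expn0.
  have [v] := pfactor_coprime p_pr S_gt0.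
  by rewrite logS prime_coprime // mulnC; exists v.
have ntzS : z ^+ S != 1.
  apply: contraTneq le_og_oz; rewrite defS => /(expg_prime_pow_mul p_pr pz pv).
  move/eqP; rewrite -order_dvdn -ltnNge => /dvdn_leq.
  rewrite expn_gt0 prime_gt0 // => /(_ isT)/leq_ltn_trans; apply.
  by rewrite og ltn_exp2l ?prime_gt1.
have og1 : #[g ^+ (p ^ r)] = p by rewrite (orderXexp r og) subSnn expn1.
have Xg1 : g ^+ (p ^ r) \in <[x]>.
  suff /subsetIP[_] : <[g ^+ (p ^ r)]> \subset <[g]> :&: <[x]>.
    by rewrite cycle_subG.
  rewrite -(cardSg_cyclic (cycle_cyclic g)) ?subsetIl ?cycleX // -orderE og1.
  have pI : p.-group (<[g]> :&: <[x]>) by apply: pgroupS pg; apply: subsetIl.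
  by have [_ ->] := pgroup_pdiv pI ntI.
have: g ^+ (p ^ r) \in <[z ^+ S]>.
  rewrite -cycle_subG -(cardSg_cyclic (cycle_cyclic x)) ?cycle_subG // ?groupX //.
  rewrite -!orderE og1.
  have pzS : p.-group <[z ^+ S]> by apply: mem_p_elt pP _; rewrite groupX.
  by have [|_ ->] := pgroup_pdiv pzS; rewrite ?cycle_eq1.
move/groupVr=> /cycleP[t]; rewrite -expgM mulnC expgM => g1t.
have ztg : (z ^+ t) ^ g = z ^+ t ^+ u by rewrite conjXg zg -!expgM mulnC.
have: (g * z ^+ t) ^+ (p ^ r) = 1.
  by rewrite (expMg_geometric (p ^ r) ztg) -g1t mulgV.
move/eqP; rewrite -order_dvdn => /dvdn_leq.
rewrite expn_gt0 prime_gt0 // => /(_ isT); apply/negP; rewrite -ltnNge.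
have /minw : w * z ^+ t \in <[z]> by rewrite groupM // mem_cycle.
by rewrite mulgA -/g og; apply: leq_trans; rewrite ltn_exp2l ?prime_gt1.
Qed.

(** As <g> meets <x> trivially and x has large order, #[g] is a power of p not
    exceeding K, hence divides the largest such power. *)
Lemma avoiding_exp1 (gT : finGroupType) p K (P : {group gT}) x g :
    prime p -> p.-group P -> TI_bound K P -> x \in P -> K < #[x] ->
    g \in P -> <[g]> :&: <[x]> = 1 ->
  g ^+ (p ^ trunc_log p K) = 1.
Proof.
move=> p_pr pP tiP Px ltKx Pg tigx.
have leg : #[g] <= K.
  by apply: (TI_bound_large tiP _ _ _ ltKx); rewrite ?cycle_subG // setIC.
have [r og] := p_natP (mem_p_elt pP Pg).
apply/eqP; rewrite -order_dvdn og dvdn_exp2l // trunc_log_max ?prime_gt1 //.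
by rewrite -og.
Qed.

(** If #[y] <= #[z], then [cycle_avoiding_coset] gives an element that acts on
    <z> as y does and has order at most K. So the K-bounded p-power e kills the
    action of y, and u - 1 can be isolated because the geometric sum of length e
    has p-part e. If #[y] > #[z], the same reasoning applied to the power of y of
    order #[z] shows that its e-th power centralises z; then its (e * k)-th power
    generates the same subgroup of <z> as z ^+ (e * k), so y centralises
    z ^+ (e * k). *)
Lemma commutator_exp1 (gT : finGroupType) p K (P : {group gT}) x y z u k :
    prime p -> p.-group P -> TI_bound K P -> x \in P -> K < #[x] ->
    y \in P -> z \in <[x]> -> z ^ y = z ^+ u -> u = 1 %[mod p ^ 2] ->
    {in 'C_P[z], forall c, c ^+ k \in <[z]>} ->
  (z^-1 * z ^ y) ^+ (p ^ trunc_log p K * k) = 1.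
Proof.
move=> p_pr pP tiP Px ltKx Py Xz zy u1 Ck; set e := (p ^ _)%N.
have Pz : z \in P by apply: subsetP Xz; rewrite cycle_subG.
have u_gt0 : 0 < u.
  rewrite lt0n; apply: contra_eq_neq u1 => ->.
  by rewrite mod0n modn_small // -{1}(exp1n 2) ltn_exp2r ?prime_gt1.
have zV : z^-1 * z ^ y = z ^+ u.-1 by rewrite zy -{1}(prednK u_gt0) expgS mulKg.
have avoid1 g v : g \in P -> z ^ g = z ^+ v -> v = 1 %[mod p ^ 2] ->
    #[g] <= #[z] -> z ^+ (v ^ e) = z.
  move=> Pg zg v1 legz.
  have [w Zw tigw] := cycle_avoiding_coset p_pr pP Px Pg Xz zg v1 legz.
  have Pw : w \in P by apply: subsetP Zw; rewrite cycle_subG.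
  have zgw : z ^ (g * w) = z ^+ v.
    rewrite conjgM zg conjXg; congr (_ ^+ _); apply/conjg_fixP/commgP.
    exact: (centsP (cycle_abelian z)) _ (cycle_id z) _ Zw.
  rewrite -(conjgX_exp e zgw).
  by rewrite (avoiding_exp1 p_pr pP tiP Px ltKx _ tigw) ?groupM ?conjg1.
rewrite zV; have [leyz | ltzy] := leqP #[y] #[z].
  rewrite expgM; suff -> : z ^+ u.-1 ^+ e = 1 by rewrite expg1n.
  have := avoid1 y u Py zy u1 leyz; rewrite -{1}(prednK (_ : 0 < u ^ e)).
    rewrite expgS predn_exp => /eqP; rewrite -{3}[z]mulg1 => /eqP/mulgI.
    rewrite expgM; have S_gt0 : 0 < \sum_(i < e) u ^ i.
      have: 0 < e by rewrite expn_gt0 prime_gt0.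
      by case: (e) => // j _; rewrite big_ord_recl expn0.
    have [v] := pfactor_coprime p_pr S_gt0.
    rewrite logn_geometric_sum // prime_coprime // mulnC => pv ->.
    by apply: (expg_prime_pow_mul p_pr _ pv); rewrite (mem_p_elt pP) ?groupX.
  by rewrite expn_gt0 u_gt0.
have [[n oz] [b oy]] := (p_natP (mem_p_elt pP Pz), p_natP (mem_p_elt pP Py)).
have ltnb : n < b by rewrite -(ltn_exp2l _ _ (prime_gt1 p_pr)) -oz -oy.
pose j := (p ^ (b - n))%N.
have oyj : #[y ^+ j] = #[z] by rewrite (orderXexp _ oy) oz subKn // ltnW.
have zyj := conjgX_exp j zy.
have uj1 : u ^ j = 1 %[mod p ^ 2] by rewrite -modnXm u1 modnXm exp1n.
have zyje : z ^ (y ^+ j ^+ e) = z.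
  by rewrite (conjgX_exp _ zyj) (avoid1 _ _ _ zyj) ?groupX ?oyj.
have Zy : y ^+ j ^+ e ^+ k \in <[z]>.
  apply: Ck; apply/setIP; split; first by rewrite !groupX.
  by rewrite cent1C; apply/cent1P/commgP/conjg_fixP.
have defZ : <[y ^+ j ^+ (e * k)]> = <[z ^+ (e * k)]>.
  apply/eqP; rewrite (eq_subG_cyclic (cycle_cyclic z)) ?cycleX //; last first.
    by rewrite expgM cycle_subG.
  by rewrite -!orderE (orderXgcd (y ^+ j)) (orderXgcd z) oyj.
have : z ^+ (e * k) \in <[y ^+ j ^+ (e * k)]> by rewrite defZ cycle_id.
rewrite -expgM => /cycleP[t zek].
have : (z ^+ (e * k)) ^ y = z ^+ (e * k).
  by rewrite zek conjXg; congr (_ ^+ _); rewrite conjXg conjgE mulKg.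
rewrite conjXg zy -{1}(prednK u_gt0) expgS expgMn; last exact: commuteX.
by rewrite -{2}[z ^+ (e * k)]mulg1 => /mulgI.
Qed.

(** An element of G that centralises generators of A lies in A, so A contains an
    intersection of centralisers of elements with few conjugates. *)
Lemma index_self_centralising (gT : finGroupType) (G A : {group gT}) (s : seq gT) q :
    A \subset <<[set x in s]>> -> 'C_G(A) \subset A ->
    (forall x, x \in s -> #|x ^: G| <= q) ->
  #|G : A| <= q ^ size s.
Proof.
move=> sAs sCA sq; apply: leq_trans _ (index_cent_set sq).
apply: dvdn_leq; rewrite ?indexg_gt0 // indexgS //.
by rewrite (subset_trans _ sCA) // setIS //= -(cent_gen [set x in s]) centS.
Qed.

Lemma card_class_commutator (gT : finGroupType) (G : {group gT}) x (D : {set gT}) :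
  {in G, forall g, [~ x, g] \in D} -> #|x ^: G| <= #|D|.
Proof.
move=> xGD; rewrite -(card_lcoset D x); apply/subset_leq_card/subsetP=> y.
by case/imsetP=> g Gg ->; rewrite mem_lcoset xGD.
Qed.

Lemma card_Ldiv_dprod_cycle (gT : finGroupType) (A R : {group gT}) x m :
    abelian A -> <[x]> \x R = A -> {in R, forall r, r ^+ m = 1} -> 0 < m ->
  #|'Ldiv_m(A)| <= m * #|R|.
Proof.
move=> cAA defA Rm m_gt0; have /dprodP[_ /= defA' cXR _] := defA.
have gL := group_Ldiv m (cycle_abelian x).
apply: leq_trans _ (leq_mul (card_Ldiv_cycle x m_gt0) (leqnn _)).
have /= -> := mul_cardG (Group gL) R.
apply: leq_trans _ (leq_pmulr _ (cardG_gt0 (Group gL :&: R))).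
apply/subset_leq_card/subsetP=> a.
case/LdivP; rewrite -defA' => /mulsgP[y r Xy Rr ->] yr1.
rewrite mem_mulg //; apply/LdivP; split=> //.
have cyr : commute y r by apply: commute_sym; apply: (centsP cXR r Rr y Xy).
by move: yr1; rewrite expgMn // (Rm r Rr) mulg1.
Qed.

(** * Cyclic subgroups of bounded index *)

(** Two factors of an elementary abelian subgroup of rank 2 would meet trivially
    and have order p > K. The lower bound on K makes p odd, which excludes the
    generalised quaternion groups. *)
Lemma TI_pgroup_gt_cyclic (gT : finGroupType) (p : nat) K (P : {group gT}) :
  p.-group P -> TI_bound K P -> 1 < K < p -> cyclic P.
Proof.
move=> pP tiP /andP[K1 ltKp].
have [-> | ntP] := eqsVneq P 1; first exact: cyclic1.
have [p_pr _ _] := pgroup_pdiv pP ntP; have [n oP] := p_natP pP.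
have oddP : odd #|P|.
  rewrite oP oddX; apply/orP; right; case: (even_prime p_pr) => // p2.
  by rewrite p2 ltnNge K1 in ltKp.
rewrite (odd_pgroup_rank1_cyclic pP oddP) leqNgt; apply/negP.
case/p_rank_geP=> E /pnElemPcard[sEP abE oE].
have [x Ex ntx] : exists2 x, x \in E & x != 1.
  by apply/trivgPn; rewrite -cardG_gt1 oE -(exp1n 2) ltn_exp2r ?prime_gt1.
have ox := abelem_order_p abE Ex ntx.
have [B [sBE oB /dprodP[_ _ _ tixB]]] := p_abelem_split1 abE Ex.
have := tiP <[x]>%G B; rewrite cycle_subG (subsetP sEP) //.
rewrite (subset_trans sBE) // -orderE oB oE ox mulnK ?prime_gt0 // minnn.
by move/(_ isT isT tixB); rewrite leqNgt ltKp.
Qed.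

(** With the notation of the proof of [TI_pgroup_large_exponent], the factors are
    bounds for the indices of the centraliser of z in P (first two factors), of A
    in that centraliser, and of <x> in A. *)
Definition large_pgroup_index_bound K := 
  (K ^ 2 * (K * (K * (K ^ 2) ^ K.+1)) * (K ^ 2) ^ K.+1 * K)%N.

(** The chain <x> <= A <= C <= P, where C is the centraliser of z := x ^+ #|R|.
    Raising to the power #|R| kills R, so it maps A onto <z>; this makes <z>
    normal in P. *)
Lemma TI_pgroup_large_exponent (gT : finGroupType) p K (P A R : {group gT}) x :
    prime p -> p <= K -> p.-group P -> TI_bound K P ->
    A <| P -> 'C_P(A) = A -> <[x]> \x R = A -> K ^ 3 < #[x] ->
  #|P : <[x]>| <= large_pgroup_index_bound K.
Proof.
move=> p_pr lepK pP tiP nsAP defC defA ltKx; have sAP := normal_sub nsAP.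
have K_gt0 : 0 < K by apply: leq_trans lepK; apply: prime_gt0.
have cAA : abelian A by rewrite /abelian -{1}defC subsetIr.
have /dprodP[_ /= defA' cXR tiXR] := defA.
have sXA : <[x]> \subset A by rewrite -defA' mulG_subl.
have sRA : R \subset A by rewrite -defA' mulG_subr.
have Ax : x \in A by rewrite -cycle_subG.
have Px : x \in P := subsetP sAP x Ax.
have ltKx1 : K < #[x].
  by apply: leq_ltn_trans ltKx; rewrite -{1}[K]expn1 leq_pexp2l.
have leRK : #|R| <= K.
  by apply: TI_bound_large tiP _ _ tiXR ltKx1; apply: subset_trans sAP.
pose m := #|R|; have m_gt0 : 0 < m := cardG_gt0 R.
have Rm : {in R, forall r, r ^+ m = 1} by move=> r /expg_cardG.
pose z := x ^+ m; have Xz : z \in <[x]> := mem_cycle x m.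
have Pz : z \in P by rewrite groupX.
have Am a : a \in A -> a ^+ m \in <[z]>.
  rewrite -defA' => /mulsgP[_ r /cycleP[i ->] Rr ->].
  have cxr : commute (x ^+ i) r.
    by apply: commute_sym; apply: (centsP cXR r Rr); apply: mem_cycle.
  by rewrite expgMn // (Rm r Rr) mulg1 -expgM mulnC expgM mem_cycle.
have Zzg g : g \in P -> z ^ g \in <[z]>.
  move=> Pg; rewrite conjXg Am // memJ_norm //.
  exact: subsetP (normal_norm nsAP) g Pg.
have ltKz : K ^ 2 < #[z].
  rewrite ltnNge; apply: contraL ltKx => lezK; rewrite -leqNgt expnSr.
  apply: leq_trans _ (leq_mul lezK leRK); rewrite dvdn_leq ?muln_gt0 ?order_gt0 //.
  by rewrite order_dvdn mulnC expgM -/z expg_order.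
(* Each of the generators x and r in R of A has at most K ^ 2 conjugates in C. *)
pose C := 'C_P[z]; pose D := ((K ^ 2) ^ K.+1)%N.
have sAC : A \subset C.
  rewrite subsetI sAP sub_cent1; apply: subsetP (subset_trans sXA cAA) z Xz.
have leCA : #|C : A| <= D.
  pose s := x :: enum R.
  apply: leq_trans (@index_self_centralising _ _ _ s (K ^ 2) _ _ _) _.
  - rewrite -defA' mul_subG ?cycle_subG ?mem_gen ?inE ?eqxx //.
    apply: subset_trans (subset_gen _); apply/subsetP=> r Rr.
    by rewrite !inE mem_enum Rr orbT.
  - by rewrite -{2}defC setSI // subsetIl.
  - move=> a sa; have Aa : a \in A.
      by move: sa; rewrite inE mem_enum => /predU1P[-> // | /(subsetP sRA)].
    apply: leq_trans (_ : #|'Ldiv_m(A)| <= _).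
      apply: card_class_commutator => c /setIP[Pc cz]; apply/LdivP.
      have Aac : a ^ c \in A by rewrite memJ_norm // (subsetP (normal_norm nsAP)).
      split; first by rewrite commgEl groupM ?groupV.
      rewrite commgEl expgMn; last by apply: (centsP cAA); rewrite ?groupV.
      have /cycleP[i az] := Am a Aa.
      rewrite -conjXg az conjXg (_ : z ^ c = z) ?expgVn ?az ?mulVg //.
      by apply/conjg_fixP/commgP; apply/cent1P; rewrite cent1C.
    apply: leq_trans (card_Ldiv_dprod_cycle cAA defA Rm m_gt0) _.
    by rewrite expnS expn1 leq_mul.
  - by rewrite leq_pexp2l ?expn_gt0 ?K_gt0 //= -cardE ltnS.
(* The index #|C : A| takes C into A, and m takes A into <z>. *)
pose k := (#|C : A| * m)%N.
have Ck : {in C, forall c, c ^+ k \in <[z]>}.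
  move=> c Cc; rewrite expgM Am //.
  have nAc : c \in 'N(A).
    by case/setIP: Cc => Pc _; apply: subsetP (normal_norm nsAP) c Pc.
  rewrite coset_idr ?groupX // morphX //= -card_quotient; last first.
    by apply: subset_trans (normal_norm nsAP); apply: subsetIl.
  by rewrite expg_cardG // mem_quotient.
have [n oz] := p_natP (mem_p_elt pP Pz).
have lt2n : 2 < n.
  rewrite ltnNge; apply: contraL ltKz; rewrite -leqNgt oz => len2.
  by apply: (@leq_trans (p ^ 2)); rewrite ?leq_exp2r ?leq_exp2l ?prime_gt1.
(* An element that centralises the subgroup <z1> of order p ^ 2 of <z> raises z
   to a power that is 1 modulo p ^ 2. *)
pose z1 := z ^+ (p ^ (n - 2)); pose P1 := 'C_P[z1].
have oz1 : #[z1] = (p ^ 2)%N by rewrite (orderXexp _ oz) subKn // ltnW.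
have lePP1 : #|P : P1| <= K ^ 2.
  rewrite index_cent1; apply: leq_trans (_ : #[z1] <= _); last first.
    by rewrite oz1 leq_exp2r.
  apply/subset_leq_card/subsetP=> y /imsetP[g Pg ->].
  rewrite conjXg; have /cycleP[i ->] := Zzg g Pg.
  by rewrite -expgM mulnC expgM mem_cycle.
pose e := (p ^ trunc_log p K)%N.
have leeK : e <= K by rewrite trunc_logP ?prime_gt1.
have e_gt0 : 0 < e by rewrite expn_gt0 prime_gt0.
have k_gt0 : 0 < k by rewrite muln_gt0 indexg_gt0.
have leP1 : #|P1 : 'C_P1[z]| <= e * k.
  rewrite index_cent1; apply: leq_trans _ (card_Ldiv_cycle z _); last first.
    by rewrite muln_gt0 e_gt0.
  apply: card_class_commutator => y /setIP[Py z1y].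
  have /cycleP[u zy] := Zzg y Py.
  have u1 : u = 1 %[mod p ^ 2].
    apply/eqP; rewrite -oz1 -eq_expg_mod_order expg1.
    rewrite /z1 -expgM mulnC expgM -zy -conjXg; apply/eqP/conjg_fixP/commgP.
    by apply/cent1P; rewrite cent1C.
  apply/LdivP; split; first by rewrite commgEl groupM ?groupV ?cycle_id ?Zzg.
  exact: (commutator_exp1 p_pr pP tiP Px ltKx1 Py Xz zy u1 Ck).
have sCP : C \subset P := subsetIl _ _.
rewrite -(Lagrange_index sAP sXA) -(Lagrange_index sCP sAC).
have -> : #|A : <[x]>| = #|R|.
  by rewrite -divgS // -(dprod_card defA) mulKn ?cardG_gt0.
apply: leq_mul => //; apply: leq_mul => //.
have sC1 : 'C_P1[z] \subset C by rewrite setSI // subsetIl.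
have sC1P1 : 'C_P1[z] \subset P1 := subsetIl _ _.
have sP1P : P1 \subset P := subsetIl _ _.
apply: leq_trans (_ : #|P : 'C_P1[z]| <= _).
  by rewrite dvdn_leq ?indexg_gt0 ?indexgS.
rewrite -(Lagrange_index sP1P sC1P1) leq_mul //.
apply: leq_trans leP1 _; rewrite leq_mul // mulnC leq_mul //.
Qed.

(** The case distinction is on p > K and on the exponent of a self-centralising
    abelian normal subgroup A. When the exponent is at most K ^ 3, both |A| and
    |P : A| are bounded, and the trivial subgroup has bounded index. *)
Lemma TI_pgroup_cyclic_index K :
    1 < K ->
  exists B, forall (gT : finGroupType) (p : nat) (P : {group gT}),
    p.-group P -> TI_bound K P -> exists2 x, x \in P & #|P : <[x]>| <= B.
Proof.
move=> K1; have K_gt0 := ltnW K1; pose a := (K.+1 * K ^ 3 * K)%N.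
have a_gt0 : 0 < a by rewrite !muln_gt0 K_gt0.
exists (a ^ a * a + large_pgroup_index_bound K)%N => gT p P pP tiP.
have [P1 | ntP] := eqsVneq P 1.
  exists 1; rewrite ?group1 // cycle1 P1 indexgg ltn_addr //.
  by rewrite muln_gt0 expn_gt0 a_gt0.
have [p_pr _ _] := pgroup_pdiv pP ntP.
have [lepK | ltKp] := leqP p K; last first.
  have [|x defP] := cyclicP (TI_pgroup_gt_cyclic pP tiP _); first by rewrite K1.
  exists x; first by rewrite defP cycle_id.
  by rewrite defP indexgg ltn_addr // muln_gt0 expn_gt0 a_gt0.
have [A maxA] : {A : {group gT} | [max A | A <| P & abelian A]}.
  by apply: ex_maxgroup; exists 1%G; rewrite normal1 abelian1.
have /SCN_P[nsAP defC] := max_SCN pP maxA; have sAP := normal_sub nsAP.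
have cAA : abelian A by rewrite /abelian -{1}defC subsetIr.
have [x [R [ox defA]]] := abelian_dprod_cycle_exponent cAA.
have Px : x \in P.
  rewrite (subsetP sAP) // -cycle_subG; have /dprodP[_ <- _ _] := defA.
  exact: mulG_subl.
have [lexK | ltKx] := leqP #[x] (K ^ 3); last first.
  exists x => //; apply: leq_trans (leq_addl _ _).
  exact: (TI_pgroup_large_exponent p_pr lepK pP tiP nsAP defC defA ltKx).
have leAa : #|A| <= a.
  apply: leq_trans (TI_bound_abelian cAA (TI_boundS sAP tiP)) _.
  by rewrite !leq_mul // -ox.
exists 1; rewrite ?group1 // cycle1 indexg1; apply: leq_trans (leq_addr _ _).
rewrite -(Lagrange sAP) mulnC leq_mul //.
have lePA : #|P : A| <= #|A| ^ size (enum A).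
  apply: index_self_centralising => [||y]; rewrite ?defC //.
    by apply: subset_trans (subset_gen _); rewrite set_enum.
  rewrite mem_enum => Ay; apply/subset_leq_card/subsetP=> _ /imsetP[g Pg ->].
  by rewrite memJ_norm // (subsetP (normal_norm nsAP)).
apply: leq_trans lePA _; rewrite -cardE.
by apply: leq_trans (leq_pexp2l a_gt0 leAa); rewrite leq_exp2r.
Qed.

(** Only the primes up to K contribute, since q ^ 1 > K for the others. *)
Lemma p'part_leq n p K :
    0 < n -> 0 < K -> (forall q, q != p -> q ^ logn q n <= K) ->
  n`_p^' <= K ^ K.+1.
Proof.
move=> n_gt0 K_gt0 leqK; rewrite (widen_partn _ (leq_maxl n K)).
rewrite (@big_cat_nat _ _ _ K.+1) ?ltnS ?leq_maxr //=.
rewrite [X in (_ * X)%N]big1_seq => [|q /andP[pq]]; last first.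
  rewrite mem_index_iota => /andP[ltKq _]; have := leqK q pq.
  case: logn => [|l]; rewrite ?expn0 // leqNgt => /negP[].
  have q_gt0 : 0 < q := leq_ltn_trans (leq0n K) ltKq.
  by apply: leq_trans ltKq _; rewrite -{1}[q]expn1 leq_pexp2l.
have <- : (\prod_(i < K.+1) K = K ^ K.+1)%N by rewrite prod_nat_const card_ord.
rewrite muln1 big_mkcond big_mkord.
by apply: leq_prod => q _; case: ifP => // pq; apply: leqK.
Qed.

(** If some Sylow p-subgroup has order greater than K, then the Sylow subgroups for
    all other primes have order at most K; if none has, p = 2 serves as well as
    any other prime. *)
Lemma TI_cyclic_index K :
    1 < K ->
  exists B, forall (gT : finGroupType) (G : {group gT}), TI_bound K G ->
    exists p : nat, exists x, [/\ x \in G, p.-elt x & #|G : <[x]>| <= B].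
Proof.
move=> K1; have K_gt0 := ltnW K1.
have [B Bp] := TI_pgroup_cyclic_index K1.
exists (K ^ K.+1 * B)%N => gT G tiG.
have [p leqK] : exists p : nat, forall q, q != p -> q ^ logn q #|G| <= K.
  have [/allP leK | /allPn[p _]] :=
      boolP (all (fun q => q ^ logn q #|G| <= K) (primes #|G|)).
    exists 2 => q _; have [/leK // | ] := boolP (q \in primes #|G|).
    by rewrite -logn_gt0 lt0n negbK => /eqP->.
  rewrite -ltnNge => ltKp; exists p => q neq_qp.
  have [P sylP] := Sylow_exists p G; have [Q sylQ] := Sylow_exists q G.
  rewrite -p_part -(card_Hall sylQ).
  apply: TI_bound_large tiG (pHall_sub sylP) (pHall_sub sylQ) _ _; last first.
    by rewrite (card_Hall sylP) p_part.
  apply: coprime_TIg; apply: pnat_coprime (pHall_pgroup sylP) _.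
  apply: sub_in_pnat (pHall_pgroup sylQ) => r _.
  by rewrite !inE => /eqP->.
have [P sylP] := Sylow_exists p G; have [pP sPG] := (pHall_pgroup sylP, pHall_sub sylP).
have [x Px leB] := Bp _ _ _ pP (TI_boundS sPG tiG).
exists p, x; split; [exact: subsetP sPG x Px | exact: mem_p_elt pP Px | ].
rewrite -(Lagrange_index sPG) ?cycle_subG // leq_mul //.
rewrite -divgS // (card_Hall sylP) -{1}(partnC p (cardG_gt0 G)) mulKn //.
exact: p'part_leq.
Qed.

(** * Degree and cyclic subgroups of prime power order *)

(** Take H of largest order among the subgroups that meet <x> trivially. A subgroup
    not containing the unique subgroup of order p of <x> meets <x> trivially, so
    the point stabiliser of [min_perm_degree_stabiliser] has order at most
    |H|. *)
Lemma min_perm_degree_cyclic_index (gT : finGroupType) (p : nat) (G : {group gT}) x :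
    x \in G -> p.-elt x -> x != 1 ->
  exists2 H : {group gT}, H \subset G &
    #|G : H| <= min_perm_degree G <= #|G : H| + #|G : <[x]>|.
Proof.
move=> Gx px ntx; have sXG : <[x]> \subset G by rewrite cycle_subG.
have ntX : <[x]> != 1 by rewrite cycle_eq1.
have [p_pr p_x [n ox]] := pgroup_pdiv px ntX.
pose avoids (H : {group gT}) := (H \subset G) && (H :&: <[x]> == 1).
have avoids1 : avoids 1%G by rewrite /avoids sub1G (setIidPl (sub1G _)) eqxx.
have [H /andP[sHG /eqP tiHX] maxH] :=
  arg_maxnP (fun H : {group gT} => #|H|) avoids1.
exists H; rewrite // min_perm_degree_le_index // andbT.
have oz : #[x ^+ (p ^ n)] = p by rewrite (orderXexp n ox) subSnn expn1.
have [||L [sLG zL leL]] := @min_perm_degree_stabiliser _ G (x ^+ (p ^ n)).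
- by rewrite groupX.
- by rewrite -order_gt1 oz prime_gt1.
apply: leq_trans leL; rewrite -(leq_pmul2l (cardG_gt0 H)) Lagrange //.
rewrite -(Lagrange sLG) leq_mul //; apply: maxH; rewrite /avoids sLG /=.
apply: contraR zL => ntI; suff: <[x ^+ (p ^ n)]> \subset L :&: <[x]>.
  by rewrite subsetI cycle_subG => /andP[].
rewrite -(cardSg_cyclic (cycle_cyclic x)) ?cycleX ?subsetIr // -orderE oz.
have pI : p.-group (L :&: <[x]>) by apply: pgroupS px; apply: subsetIr.
by have [_ ->] := pgroup_pdiv pI ntI.
Qed.

End Groups.

Import Order.TTheory GRing.Theory Num.Theory.
Local Open Scope ring_scope.

(** If both H and L had order greater than K, the sum of their indices, and so
    d(G), would be at most 2 |G| / K. *)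
Lemma large_degree_TI_bound (R : realType) (c : R) (K : nat)
    (gT : finGroupType) (G : {group gT}) :
    2 < c * K%:R -> c * #|G|%:R <= (min_perm_degree G)%:R ->
  TI_bound K G.
Proof.
move=> cK2 cG H L sHG sLG tiHL; rewrite leqNgt leq_min; apply/negP.
case/andP=> ltKH ltKL.
have leK (A : {group gT}) :
    A \subset G -> (K < #|A|)%N -> (K * #|G : A|%g <= #|G|)%N.
  by move=> sAG ltKA; rewrite -(Lagrange sAG) leq_mul2r ltnW ?orbT.
have leKd : (K * min_perm_degree G <= 2 * #|G|)%N.
  apply: (@leq_trans (K * (#|G : H|%g + #|G : L|%g))%N).
    by rewrite leq_mul2l min_perm_degree_le_index ?orbT.
  by rewrite mulnDr mul2n -addnn leq_add ?leK.
have : 2 * #|G|%:R < 2 * #|G|%:R :> R; last by rewrite ltxx.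
apply: (@lt_le_trans _ _ (c * K%:R * #|G|%:R)).
  by rewrite ltr_pM2r // ltr0n cardG_gt0.
rewrite mulrAC (le_trans (ler_wpM2r _ cG)) ?ler0n //.
by rewrite mulrC -!natrM ler_nat.
Qed.

Theorem mainTheorem5 (R : realType) (c : R) (hc : 0 < c) :
  exists C : R, forall (gT : finGroupType) (G : {group gT}),
    c * #|G|%:R <= (min_perm_degree G)%:R ->
    exists m : nat, (0 < m)%N /\
      `|(min_perm_degree G)%:R - #|G|%:R / m%:R| <= C.
Proof.
(* Adding 2 makes K > 1, which is what excludes p = 2 when p > K. *)
pose K := (Num.bound (2 / c)).+2.
have cK2 : 2 < c * K%:R.
  have /archi_boundP lt_bound : 0 <= 2 / c by rewrite divr_ge0 // ltW.
  rewrite mulrC -ltr_pdivrMr //; apply: lt_le_trans lt_bound _.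
  by rewrite ler_nat /K; do 2!apply: leqW.
have [B cyclicB] := TI_cyclic_index (isT : (1 < K)%N).
exists B%:R => gT G cG.
have [p [x [Gx px leB]]] := cyclicB _ _ (large_degree_TI_bound cK2 cG).
have quotE (H : {group gT}) : H \subset G ->
    #|G|%:R / #|H|%:R = #|G : H|%g%:R :> R.
  move=> sHG; rewrite -(Lagrange sHG) natrM mulrAC mulfV ?mul1r //.
  by rewrite pnatr_eq0 -lt0n cardG_gt0.
have [x1 | ntx] := eqVneq x 1%g.
  (* Here G itself has order at most B, and m = |G| gives the quotient 1. *)
  exists #|G|; split; first exact: cardG_gt0.
  rewrite quotE // indexgg ler_norml; apply/andP; split.
    rewrite lerBrDr addrC (le_trans _ (ler0n _ _)) // subr_le0 ler1n.
    by rewrite (leq_trans _ leB) ?indexg_gt0.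
  have ti1 : G :&: 1%G = 1%g := setIidPr (sub1G G).
  rewrite lerBlDr -natrD ler_nat.
  apply: leq_trans (min_perm_degree_le_index (subxx G) (sub1G G) ti1) _.
  by rewrite indexgg /= -(cycle1 gT) -x1 addnC leq_add2r.
have [H sHG /andP[leHd ledH]] := min_perm_degree_cyclic_index Gx px ntx.
exists #|H|; split; first exact: cardG_gt0.
rewrite quotE // ger0_norm; last by rewrite subr_ge0 ler_nat.
by rewrite lerBlDr -natrD ler_nat (leq_trans ledH) // addnC leq_add2r.
Qed.
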